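(* Let $X$ be an infinite countable set with a symmetric, irreflexive adjacency relation $\sim$ such that the resulting graph is connected and every vertex has at most $D<\infty$ neighbors. Let $q:X\to\mathbb{R}$ be such that the restriction $H$ of $\Delta+q$ to $\ell^2(X)$ is a positive self-adjoint operator. Let $\lambda\in\mathbb{R}$, let $u:X\to\mathbb{R}$ be a generalized eigenfunction of $H$ to $\lambda$, i.e. $(\Delta+q)u=\lambda u$ pointwise on $X$, and let $w:X\to(0,\infty)$ be a strictly positive Hardy weight of $H-\lambda$ outside of a finite set $K\subseteq X$, i.e. $$\langle (H-\lambda)\varphi,\varphi\rangle\ge\langle w\varphi,\varphi\rangle$$ for all finitely supported $\varphi:X\to\mathbb{R}$ vanishing on $K$. Let $\varrho(\cdot,\cdot)$ be the Agmon metric $$\varrho(x,y)=\inf_{x=x_0\sim\ldots\sim x_n=y}\ \sum_{i=0}^{n-1}\big(D\wedge w(x_i)\wedge w(x_{i+1})\big)^{1/2},$$ and $\varrho=\varrho(o,\cdot)$ for some fixed $o\in X$. If $X$ with the Agmon metric is a complete metric space and if there is $\alpha>0$ with $\alpha^2e^{\alpha}<8$ and $$u\in\ell^2\big(X,we^{-(\alpha/\sqrt D)\varrho}\big),$$ then $$u\in\ell^2\big(X,we^{(\alpha/\sqrt D)\varrho}\big).$$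
   Context: The combinatorial Laplacian acts on functions $f:X\to\mathbb{R}$ by $\Delta f(x)=\sum_{y\sim x}(f(x)-f(y))$. $\ell^2(X)$ is the real Hilbert space of square-summable functions (counting measure) with inner product $\langle\cdot,\cdot\rangle$. Since $\Delta$ is bounded on $\ell^2(X)$, $H$ is the operator $f\mapsto\Delta f+qf$ with domain $\{f\in\ell^2(X):qf\in\ell^2(X)\}$. For a weight $\mu:X\to[0,\infty)$, $u\in\ell^2(X,\mu)$ means $\sum_{x\in X}u(x)^2\mu(x)<\infty$. The infimum defining $\varrho(x,y)$ is over all finite paths from $x$ to $y$; $a\wedge b=\min(a,b)$. *)

(* Defs.v *)
From mathcomp Require Import all_boot all_order all_algebra.
From mathcomp Require Import all_classical all_reals all_analysis.

Set Implicit Arguments.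
Unset Strict Implicit.
Unset Printing Implicit Defensive.

Import Order.TTheory GRing.Theory Num.Theory.
Import numFieldNormedType.Exports.

Local Open Scope classical_set_scope.
Local Open Scope ring_scope.

Section SquareSummable.
Context {R : realType} {X : countType}.
Implicit Types (f g h : X -> R) (mu : X -> R).

Definition ell2_weighted mu : set (X -> R) :=
  [set f | (\esum_(x in [set: X]) (f x ^+ 2 * mu x)%:E < +oo)%E].

Definition ell2 : set (X -> R) := ell2_weighted (fun=> 1).

(* Since [\esum] is only meaningful for nonnegative terms, the absolutely
   convergent series sum_x f(x) g(x) is split into positive and negative parts. *)
Definition inner f g : R :=
  let F := (fun x => (f x * g x)%:E) in
  fine (\esum_(x in [set: X]) F^\+%E x - \esum_(x in [set: X]) F^\-%E x)%E.

Definition ell2_norm f : R := Num.sqrt (inner f f).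

(* A (possibly unbounded) operator on ell2 is given by its domain [dom] and a
   map [A], of which only the values on [dom] matter. *)

Definition dense_domain (dom : set (X -> R)) : Prop :=
  dom `<=` ell2 /\
  forall f, ell2 f -> forall e : R, 0 < e ->
    exists2 g, dom g & ell2_norm (f \- g) < e.

(* [adjoint_graph dom A g h]: g lies in the domain of A^* and A^* g = h. *)
Definition adjoint_graph (dom : set (X -> R)) (A : (X -> R) -> X -> R) g h :
    Prop :=
  [/\ ell2 g, ell2 h & forall f, dom f -> inner (A f) g = inner f h].

Definition self_adjoint (dom : set (X -> R)) (A : (X -> R) -> X -> R) : Prop :=
  [/\ dense_domain dom,
      (forall f, dom f -> ell2 (A f)) &
      (forall g h, adjoint_graph dom A g h <-> dom g /\ h = A g)].

Definition positive_operator (dom : set (X -> R)) (A : (X -> R) -> X -> R) :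
    Prop :=
  forall f, dom f -> 0 <= inner (A f) f.

End SquareSummable.

Section Graph.
Context {R : realType} {X : countType}.
Variable adj : rel X.
Implicit Types (f q w : X -> R) (x y : X) (p : seq X).

Definition path_between x y p : Prop := path adj x p /\ last x p = y.

Definition connected_graph : Prop := forall x y, exists p, path_between x y p.

Definition degree_le (D : nat) : Prop :=
  forall x, ([set y | adj x y] #<= `I_D)%card.

(* [\sum_(y \in A)] ranges over the finite support of the summand on A; it is
   the actual sum as soon as neighborhoods are finite. *)
Definition laplacian f x : R := \sum_(y \in [set y | adj x y]) (f x - f y).

Definition schrodinger q f x : R := laplacian f x + q x * f x.

Definition schrodinger_domain q : set (X -> R) :=
  [set f | ell2 f /\ ell2 (q \* f)].

Definition generalized_eigenfunction q (lam : R) u : Prop :=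
  forall x, schrodinger q u x = lam * u x.

Definition hardy_weight_outside q (lam : R) w (K : set X) : Prop :=
  forall phi : X -> R,
    finite_set [set x | phi x != 0] -> (forall x, K x -> phi x = 0) ->
    inner (w \* phi) phi <= inner (fun x => schrodinger q phi x - lam * phi x) phi.

Definition agmon_edge (D : nat) w x y : R :=
  Num.sqrt (Num.min D%:R (Num.min (w x) (w y))).

(* The vertices of the path starting at x and continuing with p are
   x_i = nth x (x :: p) i, so that x_(i+1) = nth x p i. *)
Definition agmon_length (D : nat) w x p : R :=
  \sum_(i < size p) agmon_edge D w (nth x (x :: p) i) (nth x p i).

Definition agmon_dist (D : nat) w x y : R :=
  inf [set agmon_length D w x p | p in [set p | path_between x y p]].

End Graph.

(* Completeness of the metric space (X, d): every Cauchy sequence converges. *)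
Definition complete_metric {R : realType} {X : Type} (d : X -> X -> R) : Prop :=
  forall s : nat -> X,
    (forall e : R, 0 < e -> exists N, forall m n : nat,
       (N <= m)%N -> (N <= n)%N -> d (s m) (s n) < e) ->
    exists x, d (s n) x @[n --> \oo] --> 0.

(* Main.v *)
(* Testing the Hardy inequality with [f u], where [u] is the eigenfunction, the
   potential drops out and
     2 sum w f^2 u^2 <= sum_(x ~ y) u(x) u(y) (f(x) - f(y))^2
   for finitely supported [f] vanishing on [K].  For
     psi = exp (alpha / (2 sqrt D) * min (rho, 2 r - rho))
   the squared gradient along an edge at [x] is at most
   (alpha^2 e^alpha / (4 D)) w(x) psi(x)^2, because the exponent varies there by
   at most alpha / (2 sqrt D) * (D /\ w(x) /\ w(y))^(1/2).  Summing over at most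
   [D] neighbors, sum w u^2 psi^2 is bounded by a constant independent of [r]
   (from the edges touching [K]) plus alpha^2 e^alpha / 8 < 1 times itself; it
   is finite by the assumption on [u].  Letting [r] grow gives the claim.
   Completeness enters through a Hopf-Rinow argument: Agmon balls are finite,
   hence truncations of [psi] are finitely supported. *)

Require Import Defs.
From mathcomp Require Import all_boot all_order all_algebra.
From mathcomp Require Import all_classical all_reals all_analysis.
From mathcomp Require Import ring lra.

Import Order.TTheory GRing.Theory Num.Theory.
Import numFieldNormedType.Exports.

Local Open Scope classical_set_scope.
Local Open Scope ring_scope.

(** * The Agmon metric and finiteness of its balls *)

Section AgmonMetric.
Context {R : realType} {X : countType} {adj : rel X} {D : nat} {w : X -> R}.
Hypothesis adj_sym : symmetric adj.
Hypothesis adj_irr : irreflexive adj.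
Hypothesis adj_conn : connected_graph adj.
Hypothesis adj_deg : degree_le adj D.
Hypothesis w_gt0 : forall x, 0 < w x.

Notation edge := (agmon_edge D w).
Notation len := (agmon_length D w).
Notation dist := (agmon_dist adj D w).

Lemma finite_neighbors x : finite_set [set y | adj x y].
Proof. by apply/finite_set_leP; exists D; exact: adj_deg. Qed.

Lemma agmon_edge_ge0 x y : 0 <= edge x y.
Proof. exact: sqrtr_ge0. Qed.

Lemma agmon_edge_gt0 x y : (0 < D)%N -> 0 < edge x y.
Proof. by move=> D0; rewrite sqrtr_gt0 lt_min ltr0n D0 lt_min !w_gt0. Qed.

Lemma agmon_edgeC x y : edge x y = edge y x.
Proof. by rewrite /agmon_edge (minC (w x)). Qed.

Lemma agmon_length_cons x y p : len x (y :: p) = edge x y + len y p.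
Proof.
rewrite /agmon_length /= big_ord_recl; congr (_ + _); apply: eq_bigr => i _.
by congr agmon_edge; apply: set_nth_default; rewrite /= ?ltnS// ltnW.
Qed.

Lemma agmon_length_nil x : len x [::] = 0.
Proof. by rewrite /agmon_length big_ord0. Qed.

Lemma agmon_length_rcons x p z : len x (rcons p z) = len x p + edge (last x p) z.
Proof.
elim: p x => [|y p IH] x /=; last by rewrite !agmon_length_cons IH addrA.
by rewrite agmon_length_cons !agmon_length_nil addr0 add0r.
Qed.

Lemma agmon_length_ge0 x p : 0 <= len x p.
Proof. by rewrite sumr_ge0// => i _; exact: agmon_edge_ge0. Qed.

Lemma agmon_dist_le x y p : path_between adj x y p -> dist x y <= len x p.
Proof.
move=> xyp; apply: ge_inf; last by exists p.
by exists 0 => _ [r _ <-]; exact: agmon_length_ge0.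
Qed.

Lemma le_agmon_dist x y (a : R) :
  (forall p, path_between adj x y p -> a <= len x p) -> a <= dist x y.
Proof.
move=> H; apply: lb_le_inf => [|_ [p xyp <-]]; last exact: H.
by have [p xyp] := adj_conn x y; exists (len x p), p.
Qed.

Lemma agmon_dist_lt x y (a : R) :
  dist x y < a -> exists2 p, path_between adj x y p & len x p < a.
Proof.
move=> /inf_lt[]; first by have [p xyp] := adj_conn x y; exists (len x p), p.
by move=> _ [p xyp <-] ?; exists p.
Qed.

Lemma agmon_dist_ge0 x y : 0 <= dist x y.
Proof. by apply: le_agmon_dist => p _; exact: agmon_length_ge0. Qed.

Lemma agmon_distxx x : dist x x = 0.
Proof.
apply/eqP; rewrite eq_le agmon_dist_ge0 andbT -(agmon_length_nil x).
exact: agmon_dist_le.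
Qed.

Lemma agmon_dist_edgel x y z : adj x y -> dist x z <= edge x y + dist y z.
Proof.
move=> xy; rewrite -lerBlDl; apply: le_agmon_dist => p [yp <-].
rewrite lerBlDl -agmon_length_cons; apply: agmon_dist_le.
by split => //=; rewrite xy.
Qed.

Lemma agmon_dist_edger x y z : adj y z -> dist x z <= dist x y + edge y z.
Proof.
move=> yz; rewrite -lerBlDr; apply: le_agmon_dist => p [xp pe].
rewrite lerBlDr -pe -agmon_length_rcons; apply: agmon_dist_le.
by split; rewrite ?last_rcons// rcons_path xp pe.
Qed.

Lemma agmon_dist_lipschitz x y z :
  adj y z -> `|dist x y - dist x z| <= edge y z.
Proof.
move=> yz; have := agmon_dist_edger x _ _ yz.
rewrite adj_sym in yz; have := agmon_dist_edger x _ _ yz.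
by rewrite (agmon_edgeC z) ler_norml => ? ?; apply/andP; split; lra.
Qed.

(** A path from elsewhere to [x] must use an edge entering [x]; there are finitely many of these,
    all of positive length. So a sequence converging to [x] is eventually constant. *)
Lemma agmon_dist_isolated x : (0 < D)%N ->
  exists2 e : R, 0 < e & forall y, dist y x < e -> y = x.
Proof.
move=> D0; have [s sE] := (finite_seqP _).1 (finite_neighbors x).
(* The starting value [1] covers a vertex without neighbors. *)
pose e := \big[Num.min/1]_(z <- s) edge z x.
have e0 : 0 < e.
  by rewrite /e; elim/big_ind: _ => // [a b ? ?|z _]; rewrite ?lt_min ?agmon_edge_gt0//; apply/andP.
have eP z : adj z x -> e <= edge z x.
  move=> zx; have zs : [set` s] z by rewrite -sE /= adj_sym.
  exact: ge_bigmin_seq.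
exists e => // y; apply: contraPP => /eqP yx; apply/negP; rewrite -leNgt.
apply: le_agmon_dist => p [].
elim: p y yx => [|z p IH] y yx /=; first by move=> _ /eqP; rewrite (negbTE yx).
move=> /andP[yz zp] px; rewrite agmon_length_cons.
have [zx|zx] := eqVneq z x; last by rewrite (le_trans (IH _ zx zp px))// lerDr agmon_edge_ge0.
rewrite zx in yz *; rewrite (le_trans (eP _ yz))//.
by rewrite lerDl agmon_length_ge0.
Qed.

Let reach x (t : R) := [set y | exists2 p, path_between adj x y p & len x p < t].

(** Pigeonhole over the finitely many first edges: apart from [x] itself, each vertex of [reach x t]
    is reached through a neighbor, with the first edge deducted from the budget [t]. *)
Let reach_step x t : infinite_set (reach x t) ->
  exists z, [/\ adj x z, edge x z < t & infinite_set (reach z (t - edge x z))].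
Proof.
move=> inf; apply: contrapT => /forallNP H; apply: inf.
apply: (@sub_finite_set _ _ ([set x] `|`
    \bigcup_(z in [set z | adj x z /\ edge x z < t]) reach z (t - edge x z))).
  move=> y [[|z p] [/=]]; first by move=> _ <- _; left.
  move=> /andP[xz zp] py; rewrite agmon_length_cons => lt; right; exists z.
    by split => //; rewrite (le_lt_trans _ lt)// lerDl agmon_length_ge0.
  by exists p => //; lra.
rewrite finite_setU; split=> //; apply: bigcup_finite.
  by apply: sub_finite_set (finite_neighbors x) => z [].
by move=> z [xz zt]; apply: contrapT => ?; apply: (H z).
Qed.

(* If a ball were infinite, one could repeatedly move to a neighbor from which
   infinitely many vertices are reachable with the length still available; this
   walk has finite length, hence is Cauchy, but never becomes stationary. *)
Lemma finite_agmon_ball x (t : R) : (0 < D)%N -> complete_metric dist ->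
  finite_set [set y | dist x y < t].
Proof.
move=> D0 complete; apply: contrapT => inf.
pose bad (a : X * R) := infinite_set (reach a.1 a.2).
have bad0 : bad (x, t).
  by apply: contra_not inf; apply: sub_finite_set => y /agmon_dist_lt.
(* The second component is the length still available; its nonnegativity bounds the nonincreasing
   sequence [r] from below. *)
pose step (a b : X * R) :=
  [/\ adj a.1 b.1, 0 <= b.2 & b.2 = a.2 - edge a.1 b.1].
have stepP (a : {a | bad a}) : {b : {b | bad b} | step (sval a) (sval b)}.
  apply: cid; case: a => -[y s] /= /reach_step[z [/= yz ys b]].
  by exists (exist bad (z, s - edge y z) b); split => //=; lra.
pose s n := iter n (fun a => sval (stepP a)) (exist bad (x, t) bad0).
pose v n := (sval (s n)).1; pose r n := (sval (s n)).2.
have sP n : step (v n, r n) (v n.+1, r n.+1) by rewrite /v /r /=; case: (stepP _) => /= ? [].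
have adjv n : adj (v n) (v n.+1) by have [] := sP n.
have rS n : r n.+1 = r n - edge (v n) (v n.+1) by have [] := sP n.
have le_r m k : r (m + k)%N <= r m.
  elim: k => [|k IH]; first by rewrite addn0.
  by rewrite addnS rS (le_trans _ IH)// lerBlDr lerDl agmon_edge_ge0.
(* Distances along the walk are at most the budget consumed, so convergence of [r] makes [v] Cauchy.
   The two orders of the arguments are estimated separately. *)
have vd1 m k : dist (v m) (v (m + k)%N) <= r m - r (m + k)%N.
  elim: k => [|k IH]; first by rewrite addn0 agmon_distxx subrr.
  rewrite addnS rS; apply: le_trans (agmon_dist_edger _ _ _ (adjv _)) _; lra.
have vd2 m k : dist (v (m + k)%N) (v m) <= r m - r (m + k)%N.
  elim: k => [|k IH]; first by rewrite addn0 agmon_distxx subrr.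
  rewrite addnS rS; have := adjv (m + k)%N; rewrite adj_sym => vv.
  by apply: le_trans (agmon_dist_edgel _ _ _ vv) _; rewrite agmon_edgeC; lra.
have r_cvg : cvgn r.
  apply: nonincreasing_is_cvgn => [m n mn|]; first by rewrite -(subnKC mn).
  (* The initial budget [t] has no sign; only the later ones are nonnegative by [step]. *)
  exists (Num.min (r 0%N) 0) => _ [[|n] _ <-]; rewrite ge_min ?lexx//.
  by have [_ -> _] := sP n; rewrite orbT.
have [y vy] : exists y, dist (v n) y @[n --> \oo] --> 0.
  apply: complete => e e0.
  have r_le n : limn r <= r n.
    by apply: nonincreasing_cvgn_ge => // m k mk; rewrite -(subnKC mk).
  have /(cvgrPdist_lt) /(_ e e0)[N _ HN] := r_cvg.
  have key m n : (N <= m)%N -> (m <= n)%N -> r m - r n < e.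
    move=> Nm mn; have := HN m Nm; rewrite ltr_norml => /andP[h _].
    by have := r_le n; lra.
  exists N => m n Nm Nn; have [mn|/ltnW nm] := leqP m n.
    by rewrite -(subnKC mn) (le_lt_trans (vd1 _ _))// subnKC// key.
  by rewrite -(subnKC nm) (le_lt_trans (vd2 _ _))// subnKC// key.
have [e e0 eP] := agmon_dist_isolated y D0.
have /cvgr0Pnorm_lt /(_ e e0)[N _ HN] := vy.
have vN n : (N <= n)%N -> v n = y.
  by move=> Nn; apply: eP; have := HN n Nn; rewrite ger0_norm ?agmon_dist_ge0.
by have := adjv N; rewrite !vN// adj_irr.
Qed.

End AgmonMetric.

(** * Reduction of infinite sums to finite ones *)

Section FiniteSums.
Context {R : realType} {X : countType}.
Implicit Types (f g mu : X -> R) (s t : seq X).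

Lemma ler_sum_uniq_subset (P : pred X) f s t : uniq s -> uniq t ->
  (forall x, x \in s -> P x -> x \in t) -> (forall x, 0 <= f x) ->
  \sum_(x <- s | P x) f x <= \sum_(x <- t) f x.
Proof.
move=> us ut st f0; rewrite -big_filter.
have usP : uniq [seq x <- s | P x] by exact: filter_uniq.
rewrite (fsbig_seq _ _ usP) (fsbig_seq _ _ ut).
rewrite (@fsbigID _ _ _ _ [set` [seq x <- s | P x]] [set` t])//=.
have -> : [set` t] `&` [set` [seq x <- s | P x]] = [set` [seq x <- s | P x]].
  by apply/setIidr => x /=; rewrite mem_filter => /andP[Px xs]; exact: st.
by rewrite lerDl fsumr_ge0.
Qed.

Lemma esum_finite_support f s : uniq s -> (forall x, 0 <= f x) ->
  (forall x, x \notin s -> f x = 0) ->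
  \esum_(x in [set: X]) (f x)%:E = (\sum_(x <- s) f x)%:E.
Proof.
move=> us f0 fs; rewrite -sumEFin (fsbig_seq _ _ us) -esum_fset//; last first.
  by move=> i _; rewrite lee_fin.
rewrite [RHS]esum_mkcond; apply: eq_esum => x _.
by case: ifPn => //; rewrite notin_setE /= => /negP/fs->.
Qed.

Lemma inner_finite_support f g s : uniq s ->
  (forall x, x \notin s -> f x * g x = 0) ->
  inner f g = \sum_(x <- s) f x * g x.
Proof.
move=> us fg; rewrite /inner.
under eq_esum do rewrite funeposE -EFin_max.
under [X in (_ - X)%E]eq_esum do rewrite funenegE -EFinN -EFin_max.
rewrite !(esum_finite_support _ _ us) /=.
- rewrite -sumrB; apply: eq_bigr => x _.
  by rewrite maxC; case: (leP 0 (f x * g x)) => ?; case: (leP _ 0) => ?; lra.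
- by move=> x; rewrite le_max lexx orbT.
- by move=> x /fg->; rewrite oppr0 maxxx.
- by move=> x; rewrite le_max lexx orbT.
- by move=> x /fg->; rewrite maxxx.
Qed.

(** With its converse below, this lets the whole argument run on finite sums with uniform bounds. *)
Lemma ell2_weighted_le mu f (M : R) :
  (forall s, uniq s -> \sum_(x <- s) f x ^+ 2 * mu x <= M) ->
  ell2_weighted mu f.
Proof.
move=> H; rewrite /ell2_weighted/=; apply: (@le_lt_trans _ _ M%:E); last exact: ltry.
apply: ge_ereal_sup => _ [A [+ _] <-].
move=> /finite_seqP[s ->]; have -> : [set` s] = [set` undup s].
  by apply/seteqP; split => x /=; rewrite mem_undup.
by rewrite -fsbig_seq ?undup_uniq// sumEFin lee_fin H ?undup_uniq.
Qed.

Lemma ell2_weighted_sum_le mu f : (forall x, 0 <= mu x) -> ell2_weighted mu f ->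
  exists M : R, forall s, uniq s -> \sum_(x <- s) f x ^+ 2 * mu x <= M.
Proof.
move=> mu0 muf; set S : \bar R := \esum_(x in [set: X]) (f x ^+ 2 * mu x)%:E.
have fmu0 x : (0 <= (f x ^+ 2 * mu x)%:E)%E by rewrite lee_fin mulr_ge0// sqr_ge0.
have Sfin : S \is a fin_num by rewrite ge0_fin_numE// esum_ge0.
exists (fine S) => s us; rewrite -lee_fin fineK// esum_ge//.
exists [set` s]; first by split; first exact: finite_seq.
by rewrite -fsbig_seq// sumEFin.
Qed.

End FiniteSums.

(** * Ground state representation of the quadratic form *)

Section Energy.
Context {R : realType} {X : countType} {adj : rel X}.
Hypothesis adj_sym : symmetric adj.

Lemma laplacian_sum_seq (f : X -> R) x s : uniq s ->
  (forall y, adj x y -> y \in s) ->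
  laplacian adj f x = \sum_(y <- s | adj x y) (f x - f y).
Proof.
by move=> us xs; symmetry; apply: bigfs => // y /xs ->.
Qed.

(* Ground state representation: the eigenvalue equation eliminates [q] and
   [lam], and the remaining sum is symmetrized in [x] and [y]. *)
Lemma energy_identity (q u f : X -> R) (lam : R) s : uniq s ->
  generalized_eigenfunction adj q lam u ->
  (forall x, f x != 0 -> x \in s /\ forall y, adj x y -> y \in s) ->
  2 * inner (fun x => schrodinger adj q (f \* u) x - lam * (f x * u x)) (f \* u) =
  \sum_(x <- s) \sum_(y <- s | adj x y) u x * u y * (f x - f y) ^+ 2.
Proof.
move=> us uE fs; rewrite (inner_finite_support _ _ _ us); last first.
  move=> x /negP xs /=; have [->|/fs[]//] := eqVneq (f x) 0.
  by rewrite mul0r mulr0.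
transitivity (2 * \sum_(x <- s) \sum_(y <- s | adj x y) f x * u x * u y * (f x - f y)).
  congr (2 * _); apply: eq_bigr => x _ /=.
  have [f0|/fs[_ xs]] := eqVneq (f x) 0.
    by rewrite f0 mul0r mulr0 big1// => y _; rewrite !mul0r.
  have := uE x; rewrite /schrodinger !(laplacian_sum_seq _ _ _ us xs) => ux.
  transitivity (f x * u x * \sum_(y <- s | adj x y) u y * (f x - f y)); last first.
    by rewrite mulr_sumr; apply: eq_bigr => y _; rewrite !mulrA.
  (* Discrete product rule. By the eigenvalue equation the last sum equals [(lam - q x) * u x],
     which supplies exactly the potential terms. *)
  have -> : \sum_(y <- s | adj x y) u y * (f x - f y) =
      \sum_(y <- s | adj x y) ((f \* u) x - (f \* u) y) -
      f x * \sum_(y <- s | adj x y) (u x - u y).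
    by rewrite mulr_sumr -sumrB; apply: eq_bigr => y _ /=; ring.
  rewrite /=; move: ux; set A := \sum_(y <- s | _) _; set B := \sum_(y <- s | _) _.
  by move=> ux; have -> : A = (lam - q x) * u x; [lra | ring].
rewrite mulr_natl mulr2n.
rewrite [X in _ + X = _](_ : _ =
  \sum_(x <- s) \sum_(y <- s | adj x y) f y * u y * u x * (f y - f x)).
  rewrite -big_split; apply: eq_bigr => x _; rewrite -big_split/=.
  by apply: eq_bigr => y _; ring.
under [RHS]eq_bigr do rewrite big_mkcond.
rewrite [RHS]exchange_big; apply: eq_bigr => x _; rewrite big_mkcond/=.
by apply: eq_bigr => y _; rewrite adj_sym.
Qed.

End Energy.

(** * Elementary estimates *)

Lemma sqr_max0_sub_le {R : realFieldType} (a b : R) :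
  (Num.max 0 a - Num.max 0 b) ^+ 2 <= (a - b) ^+ 2.
Proof.
case: (leP 0 a) => a0; case: (leP 0 b) => b0 //.
- rewrite subr0; nra.
- rewrite sub0r sqrrN; nra.
- by rewrite subrr expr0n sqr_ge0.
Qed.

Lemma mulr_sqr_ge0 {R : realDomainType} (a b c : R) :
  0 <= b -> 0 <= c -> 0 <= a ^+ 2 * (b * c).
Proof. by move=> b0 c0; rewrite mulr_ge0 ?sqr_ge0// mulr_ge0. Qed.

(** The difference is at most [d] times the larger exponential, which is at most [expR d * expR a].
    Using only [expR a] on the right costs the factor [expR (2 * d)], the source of [expR alpha] in
    the theorem. *)
Lemma expR_sub_sqr_le {R : realType} (a b d : R) : `|a - b| <= d ->
  (expR a - expR b) ^+ 2 <= d ^+ 2 * expR (2 * d) * expR a ^+ 2.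
Proof.
move=> abd; have d0 : 0 <= d by rewrite (le_trans _ abd).
have key (x y : R) : x <= y -> 0 <= expR y - expR x <= expR y * (y - x).
  move=> xy; rewrite subr_ge0 ler_expR xy /=.
  have -> : expR x = expR y * expR (x - y) by rewrite -expRD addrC subrK.
  have := expR_ge1Dx (x - y); have := expR_gt0 y; nra.
have -> : d ^+ 2 * expR (2 * d) * expR a ^+ 2 = (d * (expR d * expR a)) ^+ 2.
  by rewrite mulr2n mulrDl mul1r expRD; ring.
rewrite -[leLHS]real_normK ?num_real// ler_sqr ?nnegrE ?mulr_ge0 ?expR_ge0//.
have [ab|/ltW ba] := leP a b.
  have /andP[h1 h2] := key _ _ ab; rewrite ler0_norm ?opprB -?oppr_ge0 ?opprB//.
  rewrite (le_trans h2)// mulrC ler_pM ?subr_ge0 ?expR_ge0//.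
    by rewrite (le_trans _ abd)// distrC ler_norm.
  by rewrite -expRD ler_expR; have := ler_norm (b - a); rewrite distrC; lra.
have /andP[h1 h2] := key _ _ ba; rewrite ger0_norm// (le_trans h2)//.
rewrite mulrC ler_pM ?subr_ge0 ?expR_ge0//.
  by rewrite (le_trans _ abd)// ler_norm.
by rewrite ler_peMl ?expR_ge0// -expR0 ler_expR.
Qed.

(** Take [M] to be the supremum and absorb. Some a priori bound must exist, but its size does not
    enter the result. *)
Lemma ubound_contraction {R : realType} (E : set R) (C theta : R) : theta < 1 ->
  has_ubound E -> (forall M, ubound E M -> ubound E (C + theta * M)) ->
  ubound E (C / (1 - theta)).
Proof.
move=> t1 Eub H x Ex; have supE : has_sup E by split => //; exists x.
have : sup E <= C + theta * sup E.
  by apply: ge_sup; [exists x | exact/H/sup_upper_bound].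
move=> h; apply: (@le_trans _ _ (sup E)); first exact: sup_upper_bound.
by rewrite ler_pdivlMr ?subr_gt0//; lra.
Qed.

Lemma sum_neighbors_le {R : realType} {X : countType} {adj : rel X} {D : nat}
    (x : X) (a : R) (s : seq X) :
  degree_le adj D -> 0 <= a -> uniq s -> \sum_(y <- s | adj x y) a <= D%:R * a.
Proof.
move=> adj_deg a0 us; rewrite -big_filter big_const_seq count_predT iter_addr_0.
rewrite -[leLHS]mulr_natl ler_wpM2r// ler_nat.
apply: leq_trans (geq_card_fset_set (adj_deg x)).
apply: uniq_leq_size; first exact: filter_uniq.
move=> y; rewrite mem_filter => /andP[xy _].
by rewrite in_fset_set ?inE//; exact: finite_neighbors adj_deg _.
Qed.

(** * The Hardy inequality and absorption of the gradient term *)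

Section HardyAbsorption.
Context {R : realType} {X : countType} {adj : rel X} {D : nat}.
Hypothesis adj_sym : symmetric adj.
Hypothesis adj_deg : degree_le adj D.
Hypothesis D_gt0 : (0 < D)%N.
Context {q u w : X -> R} {lam : R} {K : set X}.
Hypothesis u_eigen : generalized_eigenfunction adj q lam u.
Hypothesis K_finite : finite_set K.
Hypothesis w_gt0 : forall x, 0 < w x.
Hypothesis w_hardy : hardy_weight_outside adj q lam w K.

Lemma hardy_gradient_le (f : X -> R) s : uniq s ->
  (forall x, K x -> f x = 0) ->
  (forall x, f x != 0 -> x \in s /\ forall y, adj x y -> y \in s) ->
  2 * \sum_(x <- s) u x ^+ 2 * (w x * f x ^+ 2) <=
  \sum_(x <- s) \sum_(y <- s | adj x y) u x * u y * (f x - f y) ^+ 2.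
Proof.
move=> us fK fs; rewrite -(energy_identity adj_sym _ _ _ _ _ us u_eigen fs).
rewrite ler_wpM2l//; apply: le_trans (w_hardy (f \* u) _ _).
- rewrite (inner_finite_support _ _ _ us); last first.
    move=> x /negP xs /=; have [->|/fs[]//] := eqVneq (f x) 0.
    by rewrite mul0r mulr0.
  by apply: ler_sum => x _ /=; rewrite le_eqVlt; apply/orP; left; apply/eqP; ring.
- apply: sub_finite_set (finite_seq s) => x /=.
  by have [->|/fs[]//] := eqVneq (f x) 0; rewrite mul0r eqxx.
- by move=> x Kx /=; rewrite fK// mul0r.
Qed.

(** [C] is fixed before [kappa] and [psi] and sees [psi] only through its envelope [P]; this makes
    it uniform in the truncation radius. At most [D] neighbors, each contributing [kappa / D], give
    [kappa], halved by the factor 2 in [hardy_gradient_le]. *)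
Lemma hardy_absorption (P : X -> R) : exists C : R,
  forall (kappa : R) (psi : X -> R), 0 <= kappa ->
  (forall x, 0 <= psi x <= P x) ->
  (forall x y, adj x y ->
    (psi x - psi y) ^+ 2 <= kappa / D%:R * w x * psi x ^+ 2) ->
  (forall e, 0 < e -> finite_set [set x | e < psi x]) ->
  forall M, (forall s, uniq s ->
      \sum_(x <- s) u x ^+ 2 * (w x * psi x ^+ 2) <= M) ->
  forall s, uniq s ->
    \sum_(x <- s) u x ^+ 2 * (w x * psi x ^+ 2) <= C + kappa / 2 * M.
Proof.
have finN : finite_set (K `|` \bigcup_(x in K) [set y | adj x y]).
  rewrite finite_setU; split=> //; apply: bigcup_finite => // x _.
  exact: finite_neighbors adj_deg x.
have [N uN NP] : exists2 N : seq X, uniq N &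
    forall x y, adj x y -> K x \/ K y -> (x \in N) && (y \in N).
  have [N NE] := (finite_seqP _).1 finN.
  exists (undup N) => [|x y xy xyK]; first exact: undup_uniq.
  rewrite !mem_undup; suff : [set` N] x /\ [set` N] y by case=> /= -> ->.
  rewrite -NE; case: xyK => ?; split.
  - by left.
  - by right; exists x.
  - by right; exists y => //=; rewrite adj_sym.
  - by left.
have [k uk kE] : exists2 k : seq X, uniq k & forall x, K x -> x \in k.
  have [k kE] := (finite_seqP _).1 K_finite.
  exists (undup k) => [|x]; first exact: undup_uniq.
  by rewrite kE /= mem_undup.
(* Crude bound for edges meeting [K], where cutting off to zero spoils the gradient estimate. [C2]
   collects these edges, [C1] the vertices of [K] lost by the cutoff. *)
pose B x y := `|u x * u y| * (P x + P y) ^+ 2.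
have B0 x y : 0 <= B x y by rewrite mulr_ge0// sqr_ge0.
pose C1 := \sum_(x <- k) u x ^+ 2 * (w x * P x ^+ 2).
pose C2 := \sum_(x <- N) \sum_(y <- N) B x y.
exists (C1 + C2 / 2) => kappa psi kappa0 psiP grad fin M MP s us.
have w0 x : 0 <= w x by exact: ltW.
have DR0 : 0 < D%:R :> R by rewrite ltr0n.
have psi0 x : 0 <= psi x by have /andP[] := psiP x.
have psileP x : psi x <= P x by have /andP[] := psiP x.
pose m x := u x ^+ 2 * (w x * psi x ^+ 2).
have m0 x : 0 <= m x by rewrite mulr_sqr_ge0 ?sqr_ge0.
(* The truncation error is linear in [e] with a factor depending only on the fixed finite [s], so it
   vanishes as [e] tends to zero. *)
suff key e : 0 < e -> \sum_(x <- s) m x <=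
    C1 + (C2 + kappa * M) / 2 + 2 * e * \sum_(x <- s) u x ^+ 2 * (w x * psi x).
  set S := \sum_(x <- s) u x ^+ 2 * (w x * psi x) in key.
  have S0 : 0 <= S by apply: sumr_ge0 => x _; rewrite mulr_sqr_ge0 ?sqr_ge0.
  apply/ler_addgt0Pr => e e0.
  have e'0 : 0 < e / (2 * S + 1) by rewrite divr_gt0//; lra.
  apply: le_trans (key _ e'0) _.
  have : e / (2 * S + 1) * (2 * S + 1) = e by rewrite divfK//; lra.
  by move: e'0; set r := e / _ => ? ?; lra.
move=> e0.
(* The truncation [max 0 (psi - e)] is finitely supported and does not increase
   the gradient of [psi], so no product rule for cutoffs is needed. *)
pose h x := if x \in K then 0 else Num.max 0 (psi x - e).
have hK x : K x -> h x = 0 by move=> Kx; rewrite /h mem_set.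
have hE x : ~ K x -> h x = Num.max 0 (psi x - e) by move=> Kx; rewrite /h memNset.
have h0 x : 0 <= h x by rewrite /h; case: ifP => // _; rewrite le_max lexx.
have hP x : h x <= P x.
  rewrite /h; case: ifP => _; have := psi0 x; have := psileP x; first lra.
  by rewrite ge_max => ? ?; apply/andP; split; lra.
have [t ut [st tP]] : exists2 t : seq X, uniq t & {subset s <= t} /\
    forall x, h x != 0 -> x \in t /\ forall y, adj x y -> y \in t.
  have : finite_set ([set` s] `|` ([set x | e < psi x] `|`
      \bigcup_(x in [set x | e < psi x]) [set y | adj x y])).
    rewrite !finite_setU; do 2?split; [exact: finite_seq|exact: fin|].
    by apply: bigcup_finite => [|x _]; [exact: fin|exact: finite_neighbors adj_deg x].
  move=> /finite_seqP[t tE]; exists (undup t); first exact: undup_uniq.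
  split=> [x xs|x hx].
    by rewrite mem_undup; have : [set` t] x by rewrite -tE; left.
  have psix : e < psi x.
    move: hx; apply: contraNT; rewrite -leNgt => ?; rewrite /h; case: ifP => // _.
    by apply/eqP/max_idPl; rewrite subr_le0.
  split=> [|y xy]; rewrite mem_undup.
    by have : [set` t] x by rewrite -tE; right; left.
  by have : [set` t] y by rewrite -tE; right; right; exists x.
(* Away from [K], [u x * u y] is at most the mean of the squares; the gradient bound is then used at
   [x] for [u x ^+ 2] and at [y] for [u y ^+ 2]. *)
have edgeP x y : adj x y -> u x * u y * (h x - h y) ^+ 2 <=
    kappa / D%:R / 2 * (m x + m y) +
    (if (x \in N) && (y \in N) then B x y else 0).
  move=> xy; have [xyK|] := pselect (K x \/ K y).
    rewrite NP//; apply: (@le_trans _ _ (B x y)); last first.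
      by rewrite lerDr mulr_ge0 ?addr_ge0// !divr_ge0// ltW.
    apply: (@le_trans _ _ (`|u x * u y| * (h x - h y) ^+ 2)).
      by rewrite ler_wpM2r ?sqr_ge0// ler_norm.
    rewrite ler_wpM2l//.
    by have := h0 x; have := h0 y; have := hP x; have := hP y; nra.
  move=> /not_orP[Kx Ky]; rewrite (hE _ Kx) (hE _ Ky).
  apply: (@le_trans _ _ (kappa / D%:R / 2 * (m x + m y))); last first.
    by rewrite lerDl; case: ifP.
  have hpsi : (Num.max 0 (psi x - e) - Num.max 0 (psi y - e)) ^+ 2 <=
      (psi x - psi y) ^+ 2.
    have -> : psi x - psi y = (psi x - e) - (psi y - e) by ring.
    exact: sqr_max0_sub_le.
  have gx := grad _ _ xy; have := grad y x; rewrite adj_sym => /(_ xy) gy.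
  set g := (_ - _) ^+ 2 in hpsi *; set G := (psi x - psi y) ^+ 2 in hpsi gx.
  have {}gy : G <= kappa / D%:R * w y * psi y ^+ 2 by rewrite /G -sqrrN opprB.
  have g0 : 0 <= g by exact: sqr_ge0.
  have a : u x ^+ 2 * G <= kappa / D%:R * m x.
    rewrite [leRHS](_ : _ = u x ^+ 2 * (kappa / D%:R * w x * psi x ^+ 2)).
      by rewrite ler_wpM2l ?sqr_ge0.
    by rewrite /m; ring.
  have b : u y ^+ 2 * G <= kappa / D%:R * m y.
    rewrite [leRHS](_ : _ = u y ^+ 2 * (kappa / D%:R * w y * psi y ^+ 2)).
      by rewrite ler_wpM2l ?sqr_ge0.
    by rewrite /m; ring.
  have c : u x * u y * g <= (u x ^+ 2 + u y ^+ 2) / 2 * g.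
    by rewrite ler_wpM2r//; have := sqr_ge0 (u x - u y); nra.
  have d : (u x ^+ 2 + u y ^+ 2) / 2 * g <= (u x ^+ 2 + u y ^+ 2) / 2 * G.
    by rewrite ler_wpM2l// divr_ge0// addr_ge0// sqr_ge0.
  lra.
have E1 : 2 * \sum_(x <- t) u x ^+ 2 * (w x * h x ^+ 2) <= kappa * M + C2.
  apply: le_trans (hardy_gradient_le _ _ ut hK tP) _.
  apply: (@le_trans _ _ (\sum_(x <- t) \sum_(y <- t | adj x y)
      (kappa / D%:R / 2 * (m x + m y) +
       if (x \in N) && (y \in N) then B x y else 0))).
    by apply: ler_sum => x _; apply: ler_sum => y; exact: edgeP.
  under eq_bigr do rewrite big_split.
  rewrite big_split; apply: lerD.
    have -> : \sum_(x <- t) \sum_(y <- t | adj x y) kappa / D%:R / 2 * (m x + m y) =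
        \sum_(x <- t) \sum_(y <- t | adj x y) kappa / D%:R * m x.
      transitivity (\sum_(x <- t) \sum_(y <- t | adj x y) kappa / D%:R / 2 * m x
          + \sum_(x <- t) \sum_(y <- t | adj x y) kappa / D%:R / 2 * m y).
        rewrite -big_split; apply: eq_bigr => x _; rewrite -big_split.
        by apply: eq_bigr => y _; rewrite /= mulrDr.
      have -> : \sum_(x <- t) \sum_(y <- t | adj x y) kappa / D%:R / 2 * m y =
          \sum_(x <- t) \sum_(y <- t | adj x y) kappa / D%:R / 2 * m x.
        under eq_bigr do rewrite big_mkcond.
        rewrite exchange_big; apply: eq_bigr => x _; rewrite [RHS]big_mkcond.
        by apply: eq_bigr => y _; rewrite adj_sym.
      rewrite -big_split; apply: eq_bigr => x _; rewrite -big_split.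
      by apply: eq_bigr => y _ /=; lra.
    apply: (@le_trans _ _ (\sum_(x <- t) kappa * m x)).
      apply: ler_sum => x _.
      apply: le_trans (sum_neighbors_le _ _ _ adj_deg _ ut) _.
        by rewrite mulr_ge0// divr_ge0// ltW.
      by rewrite [leLHS](_ : _ = kappa * m x)//; field; rewrite lt0r_neq0.
    by rewrite -mulr_sumr ler_wpM2l// MP.
  apply: (@le_trans _ _ (\sum_(x <- t | x \in N) \sum_(y <- N) B x y)).
    rewrite [leRHS]big_mkcond; apply: ler_sum => x _.
    case: (boolP (x \in N)) => xN /=; last by rewrite big1.
    apply: (@le_trans _ _ (\sum_(y <- t | y \in N) B x y)).
      rewrite big_mkcond [leRHS]big_mkcond; apply: ler_sum => y _.
      by case: (adj x y) => //; case: ifP.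
    exact: ler_sum_uniq_subset.
  by apply: ler_sum_uniq_subset => // x; apply: sumr_ge0.
have E2 : \sum_(x <- s) u x ^+ 2 * (w x * h x ^+ 2) <=
    \sum_(x <- t) u x ^+ 2 * (w x * h x ^+ 2).
  by apply: ler_sum_uniq_subset => [//|//|x /st//|x]; rewrite mulr_sqr_ge0 ?sqr_ge0.
have E3 : \sum_(x <- s | x \in k) u x ^+ 2 * (w x * P x ^+ 2) <= C1.
  by apply: ler_sum_uniq_subset => // x; rewrite mulr_sqr_ge0 ?sqr_ge0.
have E4 : \sum_(x <- s) m x <= \sum_(x <- s) (u x ^+ 2 * (w x * h x ^+ 2)
    + 2 * e * (u x ^+ 2 * (w x * psi x))
    + if x \in k then u x ^+ 2 * (w x * P x ^+ 2) else 0).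
  apply: ler_sum => x _; rewrite /m.
  have [Kx|Kx] := pselect (K x).
    rewrite kE// hK// expr0n /= !mulr0 add0r.
    apply: (@le_trans _ _ (u x ^+ 2 * (w x * P x ^+ 2))).
      by rewrite !ler_wpM2l ?sqr_ge0// ler_sqr ?nnegrE// (le_trans (psi0 x)).
    by rewrite lerDr mulr_ge0 ?mulr_sqr_ge0// mulr_ge0// ltW.
  (* If [psi x >= e], expand the square of [psi x - e]; otherwise [psi x ^+ 2 <= e * psi x]. *)
  have hx : psi x ^+ 2 <= h x ^+ 2 + 2 * e * psi x.
    by rewrite hE//; have := psi0 x; case: (leP 0 (psi x - e)) => ? ?; nra.
  apply: (@le_trans _ _ (u x ^+ 2 * (w x * (h x ^+ 2 + 2 * e * psi x)))).
    by rewrite !ler_wpM2l ?sqr_ge0.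
  rewrite [leLHS](_ : _ = u x ^+ 2 * (w x * h x ^+ 2)
    + 2 * e * (u x ^+ 2 * (w x * psi x))); last by ring.
  by rewrite lerDl; case: ifP => // _; rewrite mulr_sqr_ge0 ?sqr_ge0.
rewrite !big_split/= -big_mkcond -mulr_sumr in E4; lra.
Qed.

End HardyAbsorption.

(** * The truncated exponential weights *)

Section TruncatedWeight.
Context {R : realType} {X : countType} {adj : rel X} {D : nat} {w : X -> R}.
Hypothesis adj_sym : symmetric adj.
Hypothesis adj_irr : irreflexive adj.
Hypothesis adj_conn : connected_graph adj.
Hypothesis adj_deg : degree_le adj D.
Hypothesis D_gt0 : (0 < D)%N.
Hypothesis w_gt0 : forall x, 0 < w x.
Context {o : X} {alpha : R}.
Hypothesis alpha_gt0 : 0 < alpha.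

Notation rho := (agmon_dist adj D w o).
Notation rate := (alpha / Num.sqrt D%:R).

(* Grows like [expR (rate / 2 * rho)] up to distance [r] and then decays at the
   same rate, so that the given integrability of [u] suffices. *)
Definition truncated_weight (r : R) (x : X) : R :=
  expR (rate / 2 * Num.min (rho x) (2 * r - rho x)).

Let sqrtD_gt0 : 0 < Num.sqrt D%:R :> R.
Proof. by rewrite sqrtr_gt0 ltr0n. Qed.

Let rate_gt0 : 0 < rate.
Proof. by rewrite divr_gt0. Qed.

Lemma truncated_weight_bounds r x :
  0 <= truncated_weight r x <= expR (rate / 2 * rho x).
Proof.
rewrite expR_ge0 ler_expR ler_wpM2l ?ge_min ?lexx//.
by rewrite divr_ge0// ltW.
Qed.

(** Comes from the branch [2 * r - rho x] of the minimum; it makes the weighted sums of [u] finite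
    for each [r], though not yet uniformly. *)
Lemma truncated_weight_sqr_le r x :
  truncated_weight r x ^+ 2 <= expR (rate * (2 * r)) * expR (- rate * rho x).
Proof.
rewrite -expRM_natl -expRD ler_expR.
have : Num.min (rho x) (2 * r - rho x) <= 2 * r - rho x by rewrite ge_min lexx orbT.
by have := rate_gt0; set c := rate; nra.
Qed.

Lemma truncated_weight_gradient r x y : adj x y ->
  (truncated_weight r x - truncated_weight r y) ^+ 2 <=
  alpha ^+ 2 * expR alpha / 4 / D%:R * w x * truncated_weight r x ^+ 2.
Proof.
move=> xy; set e := agmon_edge D w x y.
have e0 : 0 <= e by exact: agmon_edge_ge0.
have eE : e ^+ 2 = Num.min D%:R (Num.min (w x) (w y)).
  by rewrite sqr_sqrtr// !le_min ler0n !ltW.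
have eD : e <= Num.sqrt D%:R by rewrite ler_sqrt ?ler0n// ge_min lexx.
have ew : e ^+ 2 <= w x by rewrite eE !ge_min lexx orbT.
have lip : `|rate / 2 * Num.min (rho x) (2 * r - rho x) -
             rate / 2 * Num.min (rho y) (2 * r - rho y)| <= rate / 2 * e.
  have r2 : 0 < rate / 2 by rewrite divr_gt0.
  rewrite -mulrBr normrM gtr0_norm// ler_wpM2l ?(ltW r2)//.
  have := agmon_dist_lipschitz (D := D) (w := w) adj_sym adj_conn o _ _ xy.
  rewrite -/e !ler_norml => /andP[? ?].
  by case: (leP (rho x)) => ?; case: (leP (rho y)) => ?; apply/andP; split; lra.
apply: le_trans (expR_sub_sqr_le _ _ _ lip) _.
rewrite ler_wpM2r ?sqr_ge0//.
(* Here the cap of the edge length by the square root of [D] is used; [d2] uses the cap by [w x]. *)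
have d1 : 2 * (rate / 2 * e) <= alpha.
  rewrite [leLHS](_ : _ = alpha * (e / Num.sqrt D%:R)); last by field; rewrite lt0r_neq0.
  by rewrite ler_piMr ?(ltW alpha_gt0)// ler_pdivrMr// mul1r.
have d2 : (rate / 2 * e) ^+ 2 <= alpha ^+ 2 / 4 / D%:R * w x.
  rewrite [leLHS](_ : _ = alpha ^+ 2 / 4 / Num.sqrt D%:R ^+ 2 * e ^+ 2); last first.
    by field; rewrite lt0r_neq0.
  by rewrite sqr_sqrtr ?ler0n// ler_wpM2l// !divr_ge0 ?sqr_ge0.
apply: (@le_trans _ _ (alpha ^+ 2 / 4 / D%:R * w x * expR alpha)).
  by rewrite ler_pM ?sqr_ge0 ?expR_ge0 ?ler_expR.
by rewrite le_eqVlt; apply/orP; left; apply/eqP; field; rewrite pnatr_eq0 -lt0n.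
Qed.

Lemma finite_truncated_weight_gt r e : complete_metric (agmon_dist adj D w) ->
  0 < e -> finite_set [set x | e < truncated_weight r x].
Proof.
(* Solving [e < expR (rate / 2 * (2 * r - rho x))] for [rho x] gives [rho x < t]. *)
move=> complete e0; pose t := 2 * r - ln e / (rate / 2).
apply: sub_finite_set (finite_agmon_ball adj_sym adj_irr adj_conn adj_deg w_gt0 o t D_gt0 complete).
move=> x /=; rewrite /truncated_weight -{1}(lnK e0) ltr_expR mulrC -ltr_pdivrMr ?divr_gt0//.
by rewrite lt_min => /andP[_]; rewrite /t; lra.
Qed.

End TruncatedWeight.

(** * Uniform bound and removal of the truncation *)

Theorem theorem2 (R : realType) (X : countType) (adj : rel X) (D : nat)
    (X_infinite : infinite_set [set: X])
    (adj_sym : symmetric adj) (adj_irr : irreflexive adj)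
    (adj_conn : connected_graph adj) (adj_deg : degree_le adj D)
    (q : X -> R)
    (H_self_adjoint : self_adjoint (schrodinger_domain q) (schrodinger adj q))
    (H_positive : positive_operator (schrodinger_domain q) (schrodinger adj q))
    (lam : R) (u : X -> R)
    (u_eigen : generalized_eigenfunction adj q lam u)
    (K : set X) (K_finite : finite_set K)
    (w : X -> R) (w_gt0 : forall x, 0 < w x)
    (w_hardy : hardy_weight_outside adj q lam w K)
    (o : X)
    (agmon_complete : complete_metric (agmon_dist adj D w))
    (alpha : R) (alpha_gt0 : 0 < alpha)
    (alpha_small : alpha ^+ 2 * expR alpha < 8)
    (u_in : ell2_weighted
       (fun x => w x * expR (- (alpha / Num.sqrt D%:R) * agmon_dist adj D w o x))
       u) :
  ell2_weighted
    (fun x => w x * expR (alpha / Num.sqrt D%:R * agmon_dist adj D w o x)) u.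
Proof.
(* For [D = 0] the convention [0^-1 = 0] makes the rate zero, so the two weights coincide. *)
have [D0|D_gt0] := posnP D.
  by move: u_in; rewrite D0 sqrtr0 invr0 mulr0 oppr0.
set c := alpha / Num.sqrt D%:R in u_in *.
set rho := agmon_dist adj D w o in u_in *.
pose kappa := alpha ^+ 2 * expR alpha / 4.
have kappa0 : 0 <= kappa by rewrite divr_ge0// mulr_ge0 ?sqr_ge0 ?expR_ge0.
have kappa2 : kappa / 2 < 1 by rewrite /kappa; lra.
have w0 x : 0 <= w x by exact: ltW.
have [M0 M0P] := ell2_weighted_sum_le _ _ (fun x => mulr_ge0 (w0 x) (expR_ge0 _)) u_in.
have [C CP] := hardy_absorption adj_sym adj_deg D_gt0 u_eigen K_finite w_gt0
  w_hardy (fun x => expR (c / 2 * rho x)).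
pose psi r : X -> R := truncated_weight (adj := adj) (D := D) (w := w) (o := o) (alpha := alpha) r.
pose sums r := [set z | exists2 s : seq X, uniq s &
  z = \sum_(x <- s) u x ^+ 2 * (w x * psi r x ^+ 2)].
(* The a priori bound from [M0] grows with [r]; the contraction replaces it by one independent of
   [r]. *)
have bound r s : uniq s ->
    \sum_(x <- s) u x ^+ 2 * (w x * psi r x ^+ 2) <= C / (1 - kappa / 2).
  move=> us; apply: (@ubound_contraction _ (sums r) _ _ kappa2); last by exists s.
    exists (expR (c * (2 * r)) * M0) => _ [t ut ->].
    apply: (@le_trans _ _ (expR (c * (2 * r)) *
        \sum_(x <- t) u x ^+ 2 * (w x * expR (- c * rho x)))).
      rewrite mulr_sumr; apply: ler_sum => x _.
      rewrite [leRHS]mulrCA ler_wpM2l ?sqr_ge0// [leRHS]mulrCA ler_wpM2l//.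
      exact: truncated_weight_sqr_le.
    by rewrite ler_wpM2l ?expR_ge0// M0P.
  move=> M MP _ [t ut ->].
  apply: (CP _ (psi r)) => //.
  - by move=> x; exact: truncated_weight_bounds.
  - by move=> x y; exact: truncated_weight_gradient.
  - by move=> e e0; exact: finite_truncated_weight_gt.
  - by move=> s' us'; apply: MP; exists s'.
apply: (ell2_weighted_le _ _ (C / (1 - kappa / 2))) => s us.
(* This radius dominates [rho] on all of [s], so there the minimum in [psi] is [rho] itself. *)
apply: le_trans (bound (\sum_(x <- s) rho x) s us).
rewrite big_seq [leRHS]big_seq; apply: ler_sum => x xs.
rewrite ler_wpM2l ?sqr_ge0// ler_wpM2l//.
have rho_le : rho x <= \sum_(x <- s) rho x.
  rewrite (big_rem x)//= lerDl; apply: sumr_ge0 => y _.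
  exact: agmon_dist_ge0.
rewrite /psi /truncated_weight -/rho -/c min_l; last by lra.
by rewrite -expRM_natl ler_expR; lra.
Qed.
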